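(* Let $v=[a_1,\ldots,a_k]_x=p/q$ be any vertex of the Farey polynomial tree, and let $p,q$ be of degree $n$. Then we may write $$v(x)=\prod_{i=1}^n\left(\frac{x-r_i}{x-s_i}\right)$$ with real numbers $r_i,s_i$ (the $r_i$ being the roots of $p$ and the $s_i$ the roots of $q$), where $s_n\leq -1$ and all $r_i,s_i$ may be ordered as $$s_n<r_n<\cdots<s_1<r_1\leq 0.$$ That is: $p$ and $q$ are fully factorable over $\mathbb{R}$ with all roots of multiplicity one, share no roots, have no positive roots, between two roots of one there is always a root of the other, and the largest root of the two is that of $p$.
   Context: The Farey polynomial tree is the infinite rooted binary tree whose nodes (vertices) carry rational functions $p(x)/q(x)$ (with $p,q$ polynomials), whose root is $\frac{x}{x+1}$, and where the node carrying $p/q$ has two children $\Phi_0(p/q)$ and $\Phi_1(p/q)$ given by $$\Phi_0\left(\frac{p(x)}{q(x)}\right)=\begin{cases}\dfrac{x\,q(x)}{x\,q(x)+p(x)} & p(0)\neq 0,\\[2ex] \dfrac{q(x)}{q(x)+p(x)/x} & p(0)=0,\end{cases}\qquad \Phi_1\left(\frac{p(x)}{q(x)}\right)=\begin{cases}\dfrac{x\,p(x)}{x\,q(x)+p(x)} & p(0)\neq 0,\\[2ex] \dfrac{p(x)}{q(x)+p(x)/x} & p(0)=0.\end{cases}$$ The polynomials $p,q$ of a vertex are the numerator and denominator produced by these formulas starting from $p=x$, $q=x+1$ at the root; they have the same degree. For $a_i\in\mathbb{Z}^+$ the vertices are labelled $$[a_1,\ldots,a_k]_x=\Phi_1^{a_1-1}\circ\Phi_0\circ\Phi_1^{a_2-1}\circ\Phi_0\circ\cdots\circ\Phi_1^{a_{k-1}-1}\circ\Phi_0\circ\Phi_1^{a_k-1}\left(\tfrac11\right),$$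 so the root is $[2]_x=[1,1]_x$ (the function $[1]_x=\frac11$ is not a vertex). *)

(* Defs.v *)
From mathcomp Require Import all_boot all_order all_algebra reals.

Set Implicit Arguments.
Unset Strict Implicit.
Unset Printing Implicit Defensive.

Import Order.TTheory GRing.Theory Num.Theory.
Local Open Scope ring_scope.

(* A vertex p/q is kept as the pair (p, q) of the numerator and denominator
   produced by the recursive formulas, not as a reduced fraction. *)

(* [p %/ 'X] is only reached when p(0) = 0, where the division is exact. *)
Definition farey_Phi0 (F : fieldType) (v : {poly F} * {poly F}) :
    {poly F} * {poly F} :=
  let: (p, q) := v in
  if p.[0] != 0 then ('X * q, 'X * q + p) else (q, q + p %/ 'X).

Definition farey_Phi1 (F : fieldType) (v : {poly F} * {poly F}) :
    {poly F} * {poly F} :=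
  let: (p, q) := v in
  if p.[0] != 0 then ('X * p, 'X * q + p) else (p, q + p %/ 'X).

Inductive farey_vertex (F : fieldType) : {poly F} * {poly F} -> Prop :=
| farey_root : farey_vertex ('X, 'X + 1)
| farey_child0 v : farey_vertex v -> farey_vertex (farey_Phi0 v)
| farey_child1 v : farey_vertex v -> farey_vertex (farey_Phi1 v).

(* The label [a_1, ..., a_k]_x; the value at the empty sequence is junk. *)
Fixpoint farey_label (F : fieldType) (a : seq nat) : {poly F} * {poly F} :=
  match a with
  | [::] => (1, 1)
  | [:: ak] => iter ak.-1 (@farey_Phi1 F) (1, 1)
  | a1 :: a' => iter a1.-1 (@farey_Phi1 F) (farey_Phi0 (farey_label F a'))
  end.

Definition root_between (R : numDomainType) (p q : {poly R}) : Prop :=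
  forall x y : R, root p x -> root p y -> x < y ->
    exists2 z : R, x < z < y & root q z.

Lemma farey_label_cons (F : fieldType) (a1 : nat) (a : seq nat) :
  a != [::] ->
  farey_label F (a1 :: a) =
    iter a1.-1 (@farey_Phi1 F) (farey_Phi0 (farey_label F a)).
Proof. by case: a. Qed.

Lemma farey_Phi0_one (F : fieldType) :
  farey_Phi0 (1, 1) = ('X, 'X + 1) :> {poly F} * {poly F}.
Proof. by rewrite /farey_Phi0 hornerC oner_eq0 mulr1. Qed.

Lemma farey_Phi1_one (F : fieldType) :
  farey_Phi1 (1, 1) = ('X, 'X + 1) :> {poly F} * {poly F}.
Proof. by rewrite /farey_Phi1 hornerC oner_eq0 mulr1. Qed.

(* The vertices are exactly the pairs labelled by a nonempty sequence of
   positive integers other than [1]. *)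
Lemma farey_vertexP (F : fieldType) (v : {poly F} * {poly F}) :
  farey_vertex v <->
  exists2 a : seq nat,
    [&& a != [::], all (leq 1) a & a != [:: 1%N]] & farey_label F a = v.
Proof.
have iter1 n w : farey_vertex w -> farey_vertex (iter n (@farey_Phi1 F) w).
  by move=> vw; elim: n => //= n; apply: farey_child1.
split.
- elim=> {v} [|v _ [a /and3P[a0 apos a1] <-]|v _ [a /and3P[a0 apos a1] <-]].
  + by exists [:: 2%N]; rewrite // -farey_Phi1_one.
  + exists (1%N :: a); last by rewrite farey_label_cons.
    by rewrite /= apos /=; case: (a) a0.
  + case: a a0 apos a1 => // -[|b] a _ // apos _.
    by exists (b.+2 :: a); [apply/and3P; split | case: (a)].
- case=> a /and3P[a0 apos a1] <- {v}.
  elim: a a0 apos a1 => // b a IHa _ /= /andP[b_gt0 apos] ab.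
  case: a => [|c a] in IHa apos ab *.
    case: b b_gt0 ab => [|[|b]] // _ _.
    change (farey_vertex (iter b.+1 (@farey_Phi1 F) (1, 1))).
    by rewrite iterSr farey_Phi1_one; apply/iter1/farey_root.
  apply: iter1.
  have [ca1|ca1] := eqVneq (c :: a) [:: 1%N].
    case: ca1 => -> ->; rewrite [X in farey_Phi0 X]/= farey_Phi0_one.
    exact: farey_root.
  by apply: farey_child0; apply: IHa.
Qed.

(* Main.v *)
(* In both cases of the recursion the children of p/q are A/(A+B) and xB/(A+B)
   with A, B monic: (A, B) = (q, p/x) if p(0) = 0 and (A, B) = (xq, p) otherwise.
   If the roots of p and q alternate then so do those of A and B, the largest
   root being that of A and the degree of B being one less. Hence A + B has
   exactly one root just below each root of A, above the next root of B, and the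
   roots of either child alternate again. *)

Require Import Defs.
From mathcomp Require Import all_boot all_order all_algebra reals.

Set Implicit Arguments.
Unset Strict Implicit.
Unset Printing Implicit Defensive.

Import Order.TTheory GRing.Theory Num.Theory.
Local Open Scope ring_scope.

(** The chain [a 0 > b 0 > a 1 > b 1 > ...], given by neighbours only. Separate counts let it cover
    both [k = m] (numerator and denominator of a vertex) and [k = m.+1] (the summands [A] and
    [B]). *)
Definition interlaced (R : numDomainType) (k m : nat) (a b : nat -> R) : Prop :=
  (forall i : nat, (i < m)%N -> b i < a i) /\
  (forall i : nat, (i.+1 < k)%N -> a i.+1 < b i).

Lemma interlaced_le (R : numDomainType) (k m : nat) (a b : nat -> R) i j :
  (k <= m.+1)%N -> interlaced k m a b -> (i <= j < k)%N -> a j <= a i.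
Proof.
move=> km [ba ab] /andP[/subnKC <-].
elim: (j - i)%N => [|d IHd]; rewrite ?addn0 // addnS => dk.
apply: le_trans (IHd (ltnW dk)); apply/ltW/(lt_trans (ab _ dk))/ba.
by rewrite -ltnS (leq_trans dk).
Qed.

Lemma interlaced_ltl (R : numDomainType) (k m : nat) (a b : nat -> R) i j :
  (m <= k <= m.+1)%N -> interlaced k m a b -> (i <= j < m)%N -> b j < a i.
Proof.
move=> /andP[mk km] abI /andP[ij jm]; apply: lt_le_trans (abI.1 j jm) _.
by apply: (interlaced_le km abI); rewrite ij (leq_trans jm).
Qed.

Lemma interlaced_ltr (R : numDomainType) (k m : nat) (a b : nat -> R) i j :
  (k <= m.+1)%N -> interlaced k m a b -> (i < j < k)%N -> a j < b i.
Proof.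
move=> km abI ijk; have /andP[ij jk] := ijk.
exact: le_lt_trans (interlaced_le km abI ijk) (abI.2 i (leq_ltn_trans ij jk)).
Qed.

Lemma nat_decreasing_uniq (R : numDomainType) (n : nat) (c : nat -> R) :
  (forall i j : nat, (i < j < n)%N -> c j < c i) ->
  uniq [seq c i | i <- index_iota 0 n].
Proof.
move=> c_dec; rewrite map_inj_in_uniq ?iota_uniq // => i j.
rewrite !mem_index_iota /= => ltin ltjn eq_c.
have [ltij|ltji|//] := ltngtP i j.
  by move: (c_dec i j); rewrite ltij ltjn eq_c ltxx => /(_ isT).
by move: (c_dec j i); rewrite ltji ltin eq_c ltxx => /(_ isT).
Qed.

(** Exactly the first [k] factors are negative at [x], and each of them absorbs one factor -1. *)
Lemma sgr_prod_XsubC (R : realDomainType) (c : nat -> R) (n k : nat) (x : R) :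
  (k <= n)%N -> (forall i : nat, (i < k)%N -> x < c i) ->
  (forall i : nat, (k <= i < n)%N -> c i < x) ->
  0 < (-1) ^+ k * (\prod_(0 <= i < n) ('X - (c i)%:P)).[x].
Proof.
move=> kn xc cx; rewrite (@big_cat_nat _ _ _ k) //= hornerM !horner_prod mulrA.
have -> : (-1) ^+ k = \prod_(0 <= i < k) (-1 : R).
  by rewrite prodr_const_nat subn0.
rewrite -big_split /=; apply: mulr_gt0; rewrite big_nat; apply: prodr_gt0 => i ik.
  by rewrite hornerXsubC mulN1r opprB subr_gt0 xc.
by rewrite hornerXsubC subr_gt0 cx.
Qed.

(** In the uses below the roots [c i] are negative, so the new root 0 goes in front to keep the
    order decreasing. *)
Lemma mulX_prod_XsubC (R : nzRingType) (c : nat -> R) (n : nat) :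
  'X * \prod_(0 <= i < n) ('X - (c i)%:P) =
  \prod_(0 <= i < n.+1) ('X - (if i is j.+1 then c j else 0)%:P).
Proof. by rewrite [RHS]big_nat_recl //= polyC0 subr0. Qed.

(** The negative product excludes a root at either endpoint, so the root given by the weak
    intermediate value theorem is interior. Passing to [- p] if necessary makes the value at [a]
    nonpositive. *)
Lemma poly_ivt_lt (R : rcfType) (p : {poly R}) (a b : R) :
  a <= b -> p.[a] * p.[b] < 0 -> exists2 x : R, a < x < b & root p x.
Proof.
wlog pa : p / p.[a] <= 0 => [IH|] leab.
  case: (lerP p.[a] 0) => [pa|pa]; first exact: IH.
  have := IH (- p); rewrite !hornerN oppr_le0 ltW // mulrNN => /(_ isT leab) H.
  by move=> /H[x abx]; rewrite rootN; exists x.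
move=> pab; have pa0 : p.[a] < 0.
  by rewrite lt_neqAle pa andbT; apply: contraTneq pab => ->; rewrite mul0r ltxx.
have pb0 : 0 < p.[b] by rewrite -(nmulr_rlt0 _ pa0).
have [|x /andP[ax xb] px] := @poly_ivt _ p a b leab; first by rewrite pa ltW.
exists x => //; rewrite !lt_neqAle ax xb !andbT.
apply/andP; split.
  by apply: contraTneq px => <-; rewrite rootE lt_eqF.
by apply: contraTneq px => ->; rewrite rootE gt_eqF.
Qed.

(** Finite choice by induction on [n]. It collects the roots found interval by interval into one
    sequence; [x0] only serves the base case. *)
Lemma nat_choice (T : Type) (x0 : T) (n : nat) (P : nat -> T -> Prop) :
  (forall i : nat, (i < n)%N -> exists x : T, P i x) ->
  exists f : nat -> T, forall i : nat, (i < n)%N -> P i (f i).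
Proof.
elim: n => [|n IHn] exP; first by exists (fun=> x0).
have [i /ltnW/exP //|f fP] := IHn.
have [x Px] := exP n (ltnSn n).
exists (fun i => if i == n then x else f i) => i.
rewrite ltnS leq_eqVlt; case: eqVneq => [-> //|_] /=; exact: fP.
Qed.

(* The values of the sum at a i and b i have signs (-1)^i and (-1)^(i+1), so it
   has a root in each ]b i, a i[; the remaining linear factor has its root
   below a m because of the sign at a m. *)
Lemma interlaced_add (R : rcfType) (m : nat) (a b : nat -> R)
    (A := \prod_(0 <= i < m.+1) ('X - (a i)%:P))
    (B := \prod_(0 <= i < m) ('X - (b i)%:P)) :
  interlaced m.+1 m a b ->
  exists d : nat -> R,
    [/\ A + B = \prod_(0 <= i < m.+1) ('X - (d i)%:P),
        forall i : nat, (i < m)%N -> b i < d i &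
        forall i : nat, (i <= m)%N -> d i < a i].
Proof.
move=> abI.
have sA i : (i < m)%N -> 0 < (-1) ^+ i.+1 * A.[b i].
  move=> im; apply: sgr_prod_XsubC => // [|j ji|j /andP[ij jm]].
  - exact: ltnW.
  - by apply: (interlaced_ltl _ abI); rewrite ?leqnSn ?leqnn // -ltnS ji.
  - by apply: (interlaced_ltr _ abI); rewrite ?ij.
have sB i : (i <= m)%N -> 0 < (-1) ^+ i * B.[a i].
  move=> im; apply: sgr_prod_XsubC => // [j ji|j /andP[ij jm]].
  - by apply: (interlaced_ltr _ abI); rewrite ?ji.
  - by apply: (interlaced_ltl _ abI); rewrite ?leqnSn ?leqnn ?ij.
have A0 i : (i <= m)%N -> A.[a i] = 0.
  move=> im; apply/rootP; rewrite /A -(big_map a xpredT (fun z => 'X - z%:P)).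
  by rewrite root_prod_XsubC map_f // mem_index_iota.
have B0 i : (i < m)%N -> B.[b i] = 0.
  move=> im; apply/rootP; rewrite /B -(big_map b xpredT (fun z => 'X - z%:P)).
  by rewrite root_prod_XsubC map_f // mem_index_iota.
have [i im|d dP] := @nat_choice _ (0 : R) m
    (fun i x => (b i < x < a i) /\ root (A + B) x).
  have [||x] := @poly_ivt_lt _ (A + B) (b i) (a i); last by exists x.
    exact/ltW/abI.1.
  (* At each endpoint one summand vanishes, so the product of the two values is [A.[b i] * B.[a i]],
     of sign (-1)^(2i+1). *)
  rewrite !hornerD (A0 _ (ltnW im)) (B0 _ im) addr0 add0r.
  have := mulr_gt0 (sA i im) (sB i (ltnW im)).
  by rewrite mulrACA -exprD addSn addnn -signr_odd /= odd_double mulN1r oppr_gt0.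
pose D := \prod_(0 <= i < m) ('X - (d i)%:P).
have Dmon : D \is monic by apply: monic_prod_XsubC.
(* The intervals []b i, a i[] are disjoint: [d j < a j < b i < d i]. *)
have d_dec i j : (i < j < m)%N -> d j < d i.
  move=> /andP[ij jm]; have im := ltn_trans ij jm.
  have [/andP[_ dja] _] := dP j jm; have [/andP[bdi _] _] := dP i im.
  apply: (lt_trans dja); apply: lt_trans bdi.
  by apply: (interlaced_ltr _ abI) => //; rewrite ij ltnS ltnW.
have szA : size A = m.+2 by rewrite /A size_prod_XsubC size_iota subn0.
have szB : size B = m.+1 by rewrite /B size_prod_XsubC size_iota subn0.
have szAB : size (A + B) = m.+2 by rewrite size_polyDl szA ?szB.
have ABmon : A + B \is monic.
  by rewrite monicE lead_coefDl ?szA ?szB // -monicE; apply: monic_prod_XsubC.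
have : D %| A + B.
  rewrite /D -(big_map d xpredT (fun z => 'X - z%:P)); apply: uniq_roots_dvdp.
    apply/allP=> _ /mapP[i + ->]; rewrite mem_index_iota => im.
    by have [] := dP i im.
  by rewrite uniq_rootsE nat_decreasing_uniq.
case/(Pdiv.IdomainMonic.dvdpP Dmon) => Q ABQ.
have Qmon : Q \is monic by rewrite -(monicMr _ Dmon) -ABQ.
(* Degrees [m.+1] and [m] leave a monic linear quotient; its root [c] is the missing [d m]. *)
have [c Qc] : exists c, Q = 'X - c%:P.
  have szQ : size Q = 2%N.
    move: szAB; rewrite ABQ size_Mmonic ?monic_neq0 //.
    rewrite /D size_prod_XsubC size_iota subn0 addnS /=.
    by rewrite -(addn2 m) addnC => /addnI.
  exists (- Q`_0); apply/polyP=> -[|[|i]].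
  - by rewrite coefB coefX coefC /= sub0r opprK.
  - move: Qmon; rewrite monicE lead_coefE szQ => /eqP /= ->.
    by rewrite coefB coefX coefC subr0.
  - by rewrite nth_default ?szQ // coefB coefX coefC subr0.
exists (fun i => if (i < m)%N then d i else c); split => [|i im|i].
- rewrite big_nat_recr //= ltnn ABQ mulrC Qc; congr (_ * _).
  by apply: eq_big_nat => i /andP[_ ->].
- by rewrite im; have [/andP[]] := dP i im.
- rewrite leq_eqVlt; case: ltnP => [im _|_]; first by have [/andP[]] := dP i im.
  rewrite orbF => /eqP -> {i}.
  (* All [m] roots of [D] lie above [a m], so [D] and [B] both have sign (-1)^m there. As [A]
     vanishes at [a m], the value of [D] times [a m - c] equals that of [B], whence [c < a m]. *)
  have := sB m (leqnn m).
  have <- : (A + B).[a m] = B.[a m] by rewrite hornerD A0 // add0r.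
  rewrite ABQ Qc hornerM hornerXsubC mulrCA.
  rewrite pmulr_lgt0 ?subr_gt0 //; apply: sgr_prod_XsubC => // i; last first.
    by rewrite ltnNge => /andP[->].
  move=> im; have [/andP[bdi _] _] := dP i im; apply: lt_trans bdi.
  by apply: (interlaced_ltr _ abI); rewrite ?im ltnSn.
Qed.

(** The invariant of the induction on the tree. The bound on [r 0] lets 0 be inserted as the largest
    root; the bound on [s n] passes to the children because the least root only decreases. *)
Definition interlaced_vertex (R : numDomainType) (v : {poly R} * {poly R}) :
    Prop :=
  exists n r s,
    [/\ v = (\prod_(0 <= i < n.+1) ('X - (r i)%:P),
             \prod_(0 <= i < n.+1) ('X - (s i)%:P)),
        interlaced n.+1 n.+1 r s, r 0%N <= 0 & s n <= -1].

(** Since [a i.+1 < b i < d i < a i], the roots [d] of the sum alternate with [a], and also with [b]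
    preceded by 0, as [d 0 < a 0 <= 0]. The least one satisfies [d m < a m <= -1]. *)
Lemma interlaced_vertex_add (R : rcfType) (m : nat) (a b : nat -> R)
    (A := \prod_(0 <= i < m.+1) ('X - (a i)%:P))
    (B := \prod_(0 <= i < m) ('X - (b i)%:P)) :
  interlaced m.+1 m a b -> a 0%N <= 0 -> a m <= -1 ->
  interlaced_vertex (A, A + B) /\ interlaced_vertex ('X * B, A + B).
Proof.
move=> abI a0 am; have [d [ABd bd da]] := interlaced_add abI.
have dm : d m <= -1 by apply: le_trans am; apply/ltW/da.
split; rewrite ABd.
  exists m, a, d; split=> //; split=> i im; first exact: da.
  exact: lt_trans (abI.2 i im) (bd i im).
exists m, (fun i => if i is j.+1 then b j else 0), d; split=> //.
  by rewrite mulX_prod_XsubC.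
split=> [[|i] im|i im]; last exact: bd.
  exact: lt_le_trans (da 0%N im) a0.
exact: lt_trans (da i.+1 im) (abI.2 i im).
Qed.

(** If [p.[0] = 0], dropping the top root 0 of [p] leaves [s 0] on top; otherwise 0, added to the
    roots of [q], goes strictly above [r 0]. Either way the children are the two pairs of
    [interlaced_vertex_add]. *)
Lemma farey_Phi_interlaced (R : rcfType) (v : {poly R} * {poly R}) :
  interlaced_vertex v ->
  interlaced_vertex (farey_Phi0 v) /\ interlaced_vertex (farey_Phi1 v).
Proof.
case=> n [r [s [-> [sr rs] r0 sn]]]; rewrite /farey_Phi0 /farey_Phi1.
set p := \prod_(_ <= _ < _) ('X - (r _)%:P).
set q := \prod_(_ <= _ < _) ('X - (s _)%:P).
(* The roots after [r 0] are strictly below [r 0 <= 0], so only [r 0] can be 0. *)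
have p0 : (p.[0] == 0) = (r 0%N == 0).
  rewrite /p big_nat_recl // hornerM hornerXsubC sub0r mulf_eq0 oppr_eq0.
  case: eqP => //= r0n; apply/negbTE.
  rewrite horner_prod prodf_seq_neq0; apply/allP=> i; rewrite mem_index_iota /=.
  move=> ltin; rewrite hornerXsubC sub0r oppr_eq0 lt_eqF //.
  have rI : interlaced n.+1 n.+1 r s by split.
  apply: lt_le_trans r0; apply: lt_trans (rs i ltin) _.
  apply: (interlaced_ltl _ rI); first by rewrite leqnn leqnSn.
  exact: ltnW.
rewrite p0; have [r00|r0n] /= := eqVneq (r 0%N) 0.
  have pX : p = 'X * \prod_(0 <= i < n) ('X - (r i.+1)%:P).
    by rewrite /p big_nat_recl //= r00 polyC0 subr0.
  have -> : p %/ 'X = \prod_(0 <= i < n) ('X - (r i.+1)%:P).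
    by rewrite pX mulrC mulpK ?polyX_eq0.
  rewrite pX.
  apply: (@interlaced_vertex_add _ n s (fun i => r i.+1)) => //.
    by split=> i im; [apply: rs | apply: sr].
  by rewrite ltW // -r00 sr.
rewrite mulX_prod_XsubC.
apply: (@interlaced_vertex_add _ n.+1 (fun i => if i is j.+1 then s j else 0) r).
- split=> [[|i] im|i im]; last exact: sr.
  + by rewrite lt_neqAle r0n.
  + exact: rs.
- exact: lexx.
- exact: sn.
Qed.

Lemma farey_vertex_interlaced (R : rcfType) (v : {poly R} * {poly R}) :
  farey_vertex v -> interlaced_vertex v.
Proof.
elim=> {v} [|v _ /farey_Phi_interlaced[] //|v _ /farey_Phi_interlaced[] //].
exists 0%N, (fun=> 0), (fun=> -1); split=> //; last by split=> // i _; apply: ltrN10.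
by rewrite !big_nat1 polyC0 subr0 polyCN opprK.
Qed.

Theorem proposition2p7 (R : realType) (a : seq nat) (p q : {poly R}) (n : nat)
    (ha0 : a != [::]) (hapos : all (leq 1) a)
    (hlabel : farey_label R a = (p, q))
    (hvertex : farey_vertex (p, q))
    (hn : n = (size p).-1) :
  (exists r s : nat -> R,
    [/\ (0 < n)%N,
        tofrac p / tofrac q =
          \prod_(1 <= i < n.+1)
            (tofrac ('X - (r i)%:P) / tofrac ('X - (s i)%:P)),
        p = lead_coef p *: \prod_(1 <= i < n.+1) ('X - (r i)%:P) /\
        q = lead_coef q *: \prod_(1 <= i < n.+1) ('X - (s i)%:P),
        s n <= -1 &
        [/\ forall i : nat, (1 <= i <= n)%N -> s i < r i,
            forall i : nat, (1 <= i < n)%N -> r i.+1 < s i &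
            r 1%N <= 0]]) /\
  [/\ size p = n.+1 /\ size q = n.+1,
      (forall x : R, root p x -> mup x p = 1%N) /\
      (forall x : R, root q x -> mup x q = 1%N),
      (forall x : R, ~~ (root p x && root q x)) /\
      (forall x : R, root p x || root q x -> x <= 0),
      root_between p q /\ root_between q p &
      exists2 x : R, root p x & forall y : R, root p y || root q y -> y <= x].
Proof.
have [m [r [s [[pE qE] rsI r0 sm]]]] := farey_vertex_interlaced hvertex.
have pE' : p = \prod_(z <- [seq r i | i <- index_iota 0 m.+1]) ('X - z%:P).
  by rewrite pE big_map.
have qE' : q = \prod_(z <- [seq s i | i <- index_iota 0 m.+1]) ('X - z%:P).
  by rewrite qE big_map.
have r_lt_s i j : (i < j <= m)%N -> r j < s i.
  by apply: (interlaced_ltr _ rsI).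
have s_lt_r i j : (i <= j <= m)%N -> s j < r i.
  by apply: (interlaced_ltl _ rsI); rewrite leqnn leqnSn.
have r_dec i j : (i < j <= m)%N -> r j < r i.
  move=> /andP[ij jm]; apply: (@lt_trans _ _ (s i)).
    by rewrite r_lt_s ?ij.
  by rewrite s_lt_r // leqnn (leq_trans (ltnW ij)).
have s_dec i j : (i < j <= m)%N -> s j < s i.
  move=> /andP[ij jm]; apply: (@lt_trans _ _ (r j)).
    by rewrite s_lt_r // leqnn.
  by rewrite r_lt_s ?ij.
have uniq_r := @nat_decreasing_uniq _ m.+1 r r_dec.
have uniq_s := @nat_decreasing_uniq _ m.+1 s s_dec.
have rootpP x : reflect (exists2 i, (i <= m)%N & x = r i) (root p x).
  rewrite pE' root_prod_XsubC; apply: (iffP mapP) => -[i im ->]; exists i => //.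
    by rewrite mem_index_iota in im.
  by rewrite mem_index_iota.
have rootqP x : reflect (exists2 i, (i <= m)%N & x = s i) (root q x).
  rewrite qE' root_prod_XsubC; apply: (iffP mapP) => -[i im ->]; exists i => //.
    by rewrite mem_index_iota in im.
  by rewrite mem_index_iota.
have le_r0 x : root p x || root q x -> x <= r 0%N.
  case/orP=> [/rootpP[[|i] im ->]|/rootqP[i im ->]] //.
    by rewrite ltW // r_dec.
  by rewrite ltW // s_lt_r.
have szp : size p = m.+2 by rewrite pE size_prod_XsubC size_iota subn0.
have szq : size q = m.+2 by rewrite qE size_prod_XsubC size_iota subn0.
have lcp : lead_coef p = 1 by rewrite pE lead_coef_prod_XsubC.
have lcq : lead_coef q = 1 by rewrite qE lead_coef_prod_XsubC.
rewrite hn szp /=; split.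
  (* The statement counts the roots from 1, the invariant from 0; [n] is [m.+1]. *)
  exists (fun i => r i.-1), (fun i => s i.-1); split=> //.
  - by rewrite big_add1 /= prodf_div -!rmorph_prod -pE -qE.
  - by rewrite lcp lcq !scale1r !big_add1 /= -pE -qE.
  - split=> [[|i] // im|[|i] // im|//] /=.
      by rewrite s_lt_r // leqnn.
    by rewrite r_lt_s // ltnSn.
split=> //.
(* The multiplicity is the number of occurrences in the list of roots, which is duplicate-free. *)
- split=> x px.
    by rewrite pE' mu_prod_XsubC count_uniq_mem // -root_prod_XsubC -pE' px.
  by rewrite qE' mu_prod_XsubC count_uniq_mem // -root_prod_XsubC -qE' px.
- split=> x; last by move/le_r0/le_trans; apply.
  apply/andP=> -[/rootpP[i im ->] /rootqP[j jm]].
  (* A common root [r i = s j] contradicts [r i < s j] if [j < i], and [s j < r i] if [i <= j]. *)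
  case: (ltnP j i) => [ji|ij] rs.
    by have := r_lt_s j i; rewrite ji im rs ltxx => /(_ isT).
  by have := s_lt_r i j; rewrite ij jm rs ltxx => /(_ isT).
- split=> x y.
    move=> /rootpP[i im ->] /rootpP[j jm ->] rij.
    have ji : (j < i)%N.
      rewrite ltnNge; apply/negP; rewrite leq_eqVlt => /orP[/eqP eij|ij].
        by rewrite eij ltxx in rij.
      by have := lt_trans rij (r_dec i j _); rewrite ij jm ltxx => /(_ isT).
    (* From [j < i] follows [r i < s j < r j]; for two roots of [q] below, the chain is
       [s i < r i < s j]. *)
    exists (s j); last by apply/rootqP; exists j.
    by rewrite r_lt_s ?ji // s_lt_r // leqnn.
  move=> /rootqP[i im ->] /rootqP[j jm ->] sij.
  have ji : (j < i)%N.
    rewrite ltnNge; apply/negP; rewrite leq_eqVlt => /orP[/eqP eij|ij].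
      by rewrite eij ltxx in sij.
    by have := lt_trans sij (s_dec i j _); rewrite ij jm ltxx => /(_ isT).
  exists (r i); last by apply/rootpP; exists i.
  by rewrite s_lt_r ?leqnn // r_lt_s ?ji.
- by exists (r 0%N) => //; apply/rootpP; exists 0%N.
Qed.
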